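(* Let $\mathrm{U}$ be a countable homogeneous relational structure whose age $\mathfrak{A}$ is a free amalgamation age and whose automorphism group acts transitively on $U$. Let $c:U\to 2$. If for some $i\in 2$ the age of $\mathrm{U}_{\downarrow c^{-1}(i)}$ is not equal to $\mathfrak{A}$, then there is an embedding $f$ of $\mathrm{U}$ into $\mathrm{U}$ with $f[U]\subseteq c^{-1}(1-i)$. (In particular $\mathrm{U}$ is age indivisible.)
   Context: Relational languages have no $0$-ary symbols and relations hold only on tuples of pairwise distinct elements. Embeddings are injections preserving and reflecting all relations; $\mathrm{U}_{\downarrow S}$ is the induced substructure on $S$; the age of a structure is the class of finite structures embeddable in it. Homogeneous: every isomorphism between finite induced substructures extends to an automorphism. Distinct $a,b\in F$ are Gaifman-adjacent in $F$ if some relation holds on a tuple from $F$ containing both. A free amalgamation age is a class of finite structures closed under induced substructures and under free amalgams, where the free amalgam of structures on $B\cup C$ and $B\cup C'$ ($B,C,C'$ disjoint) agreeing on $B$ is the structure on $B\cup C\cup C'$ restricting to both with no Gaifman adjacency between $C$ and $C'$. Age indivisible: for every partition $(S_0,S_1)$ of $U$, one of $\mathrm{U}_{\downarrow S_0},\mathrm{U}_{\downarrow S_1}$ has age $\mathfrak{A}$. *)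

(* Defs.v *)
From HB Require Import structures.
From mathcomp Require Import all_boot.

Set Implicit Arguments.
Unset Strict Implicit.
Unset Printing Implicit Defensive.

Record language := Language {
  symbol :> Type;
  arity : symbol -> nat;
  arity_gt0 : forall R : symbol, 0 < arity R
}.

Record structure (L : language) (T : eqType) := Structure {
  interp :> forall R : L, (arity R).-tuple T -> Prop;
  interp_uniq : forall (R : L) (t : (arity R).-tuple T), interp t -> uniq t
}.

Definition embedding (L : language) (T T' : eqType)
    (M : structure L T) (N : structure L T') (f : T -> T') : Prop :=
  injective f /\
  forall (R : L) (t : (arity R).-tuple T), N R (map_tuple f t) <-> M R t.

Definition isomorphism (L : language) (T T' : eqType)
    (M : structure L T) (N : structure L T') (f : T -> T') : Prop :=
  bijective f /\ embedding M N f.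

Definition automorphism (L : language) (T : eqType)
    (M : structure L T) (f : T -> T) : Prop :=
  isomorphism M M f.

Lemma induced_uniq (L : language) (T : eqType) (M : structure L T)
    (P : pred T) (R : L) (t : (arity R).-tuple {x : T | P x}) :
  M R (map_tuple val t) -> uniq t.
Proof. by move/interp_uniq; rewrite (map_inj_uniq val_inj). Qed.

Definition induced (L : language) (T : eqType) (M : structure L T)
    (P : pred T) : structure L {x : T | P x} :=
  Structure (@induced_uniq L T M P).

Definition fin_class (L : language) : Type :=
  forall T : finType, structure L T -> Prop.

Definition same_class (L : language) (A A' : fin_class L) : Prop :=
  forall (T : finType) (F : structure L T), A T F <-> A' T F.

Definition age (L : language) (T : eqType) (M : structure L T) : fin_class L :=
  fun F S => exists f : F -> T, embedding S M f.

(* Finite subsets of the carrier are represented by finite sequences. *)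
Definition homogeneous (L : language) (T : eqType) (M : structure L T) : Prop :=
  forall (s s' : seq T)
         (f : {x : T | x \in s} -> {x : T | x \in s'}),
    isomorphism (induced M (mem s)) (induced M (mem s')) f ->
    exists2 g : T -> T, automorphism M g & forall x, g (val x) = val (f x).

Definition transitive_automorphisms (L : language) (T : eqType)
    (M : structure L T) : Prop :=
  forall x y : T, exists2 g : T -> T, automorphism M g & g x = y.

Definition gaifman_adjacent (L : language) (T : eqType) (M : structure L T)
    (a b : T) : Prop :=
  a <> b /\
  exists (R : L) (t : (arity R).-tuple T), [/\ M R t, a \in t & b \in t].

(* The disjoint sets B, C, C' are finite types, and disjoint unions are sum   *)
(* types: B + C, B + C' and (B + C) + C'. The inclusion of B + C is inl, that *)
(* of B + C' is the following map.                                            *)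
Definition amalgam_inr (B C C' : Type) (x : B + C') : (B + C) + C' :=
  match x with inl b => inl (inl b) | inr c => inr c end.

Definition agree_on_base (L : language) (B C C' : finType)
    (M : structure L (B + C)%type) (M' : structure L (B + C')%type) : Prop :=
  forall (R : L) (t : (arity R).-tuple B),
    M R (map_tuple inl t) <-> M' R (map_tuple inl t).

(* Existence and uniqueness (up to equivalence of the relations) of D are the *)
(* two lemmas that follow.                                                    *)
Definition is_free_amalgam (L : language) (B C C' : finType)
    (M : structure L (B + C)%type) (M' : structure L (B + C')%type)
    (D : structure L (B + C + C')%type) : Prop :=
  [/\ embedding M D inl,
      embedding M' D (@amalgam_inr B C C')
    & forall (c : C) (c' : C'), ~ gaifman_adjacent D (inl (inr c)) (inr c')].

Lemma amalgam_inr_inj (B C C' : Type) : injective (@amalgam_inr B C C').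
Proof. by move=> [b|c] [b'|c'] //= [->]. Qed.

Lemma free_amalgam_exists (L : language) (B C C' : finType)
    (M : structure L (B + C)%type) (M' : structure L (B + C')%type) :
  agree_on_base M M' ->
  exists D : structure L (B + C + C')%type, is_free_amalgam M M' D.
Proof.
set in2 := @amalgam_inr B C C'.
have inj1 : injective (@inl (B + C) C') by move=> x y [].
have inj2 : injective in2 by exact: amalgam_inr_inj.
pose rel (R : L) (t : (arity R).-tuple (B + C + C')%type) :=
  (exists2 u, M R u & t = map_tuple inl u) \/
  (exists2 u, M' R u & t = map_tuple in2 u).
move=> agr.
have relU R t : @rel R t -> uniq t.
  by case=> -[u /interp_uniq Hu ->]; rewrite map_inj_uniq.
have base (R : L) (u : (arity R).-tuple (B + C)%type)
    (v : (arity R).-tuple (B + C')%type) :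
  map_tuple inl u = map_tuple in2 v ->
  exists b : (arity R).-tuple B, u = map_tuple inl b /\ v = map_tuple inl b.
- move=> e.
  have H i : exists b, tnth u i = inl b /\ tnth v i = inl b.
    have := congr1 (fun t => tnth t i) e; rewrite !tnth_map.
    by case: (tnth u i) (tnth v i) => [b|c] [b'|c'] //= [->]; exists b'.
  have H' i : exists b, (tnth u i == inl b) && (tnth v i == inl b).
    by have [b [-> ->]] := H i; exists b; rewrite !eqxx.
  exists [tuple xchoose (H' i) | i < arity R].
  by split; apply: eq_from_tnth => i; rewrite tnth_map tnth_mktuple;
    have /andP[/eqP ? /eqP ?] := xchooseP (H' i).
exists (Structure relU); split.
- split=> // R t; split=> [|Mt]; last by left; exists t.
  case=> -[u Mu e].
    by rewrite (_ : t = u) //; apply/val_inj/(inj_map inj1)/(congr1 val e).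
  have [b [-> eu]] := base _ _ _ e.
  by apply/agr; rewrite -eu.
- split=> // R t; split=> [|Mt]; last by right; exists t.
  case=> -[u Mu e]; last first.
    by rewrite (_ : t = u) //; apply/val_inj/(inj_map inj2)/(congr1 val e).
  have [b [eu ->]] := base _ _ _ (esym e).
  by apply/agr; rewrite -eu.
- move=> c c' [_ [R [t [[] [u _ ->]]]]].
    by move=> _ /mapP[].
  by move=> /mapP[[]].
Qed.

Lemma free_amalgam_unique (L : language) (B C C' : finType)
    (M : structure L (B + C)%type) (M' : structure L (B + C')%type)
    (D D' : structure L (B + C + C')%type) :
  is_free_amalgam M M' D -> is_free_amalgam M M' D' ->
  forall (R : L) (t : (arity R).-tuple (B + C + C')%type), D R t <-> D' R t.
Proof.
have half (E E' : structure L (B + C + C')%type) :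
  is_free_amalgam M M' E -> is_free_amalgam M M' E' ->
  forall (R : L) (t : (arity R).-tuple (B + C + C')%type), E R t -> E' R t.
- move=> [[_ e1] [_ e2] free] [[_ e1'] [_ e2'] _] R t Et.
  have [/hasP[[//|c'] c't _]|/hasPn noC'] :=
      boolP (has (fun x => if x is inr _ then true else false) t).
    pose g (x : B + C + C') : B + C' :=
      match x with inl (inl b) => inl b | _ => inr
        match x with inr c => c | _ => c' end end.
    have tE : t = map_tuple (@amalgam_inr B C C') (map_tuple g t).
      apply: eq_from_tnth => i; rewrite !tnth_map.
      have := mem_tnth i t; case: (tnth t i) => [[b|c]|c] //= ct.
      by case: (free c c'); split=> //; exists R, t.
    by move: Et; rewrite tE => /e2 /e2'.
  case: (pickP (fun _ : 'I_(arity R) => true)) => [i0 _|ar0]; last first.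
    by have := ar0 (Ordinal (arity_gt0 R)).
  have [x0 _] : exists x0 : B + C, true.
    have := noC' _ (mem_tnth i0 t).
    by case: (tnth t i0) => // x; exists x.
  pose g (x : B + C + C') : B + C := if x is inl y then y else x0.
  have tE : t = map_tuple (@inl (B + C) C') (map_tuple g t).
    apply: eq_from_tnth => i; rewrite !tnth_map.
    by have := noC' _ (mem_tnth i t); case: (tnth t i).
  by move: Et; rewrite tE => /e1 /e1'.
by move=> HD HD' R t; split; apply: half.
Qed.

(* A class of finite structures is understood up to isomorphism. *)
Definition free_amalgamation_age (L : language) (A : fin_class L) : Prop :=
  [/\ forall (T T' : finType) (F : structure L T) (F' : structure L T')
             (f : T -> T'), isomorphism F F' f -> A T F -> A T' F',
      forall (T : finType) (F : structure L T) (P : pred T),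
        A T F -> A {x : T | P x} (induced F P)
    & forall (B C C' : finType)
             (M : structure L (B + C)%type) (M' : structure L (B + C')%type)
             (D : structure L (B + C + C')%type),
        agree_on_base M M' -> is_free_amalgam M M' D ->
        A (B + C)%type M -> A (B + C')%type M' -> A (B + C + C')%type D].

Definition age_indivisible (L : language) (T : eqType)
    (M : structure L T) : Prop :=
  forall S0 S1 : pred T, (forall x, S1 x = ~~ S0 x) ->
    same_class (age (induced M S0)) (age M) \/
    same_class (age (induced M S1)) (age M).

(* Main.v *)
(* Let w be a finite subset of U and H a finite set such that no copy of w in
   the class c^-1(i) is freely placed with respect to H, chosen with |w| minimal
   (H = empty and w not embeddable in c^-1(i) shows that there is one). Write
   w = a :: v; then v has copies in c^-1(i) that are free from any prescribed
   finite set. Given a finite set G disjoint from H and y outside G, move y by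
   an automorphism over G to a point x that is free from H over G. By free
   amalgamation over x, which has the type of a by transitivity, one may further
   assume that (x, v') is a copy of (a, v) where v' is free from the union of G
   and H, and v' can be taken in c^-1(i) since such free positions form one
   orbit. The copy (x, v') of w is free from H, so x has the other colour. Hence
   every one-point type is realized in the other class, outside H, and an
   embedding is built point by point. *)
Require Import Defs.
From mathcomp Require Import all_boot.
From Stdlib Require Import ClassicalEpsilon.

Set Implicit Arguments.
Unset Strict Implicit.
Unset Printing Implicit Defensive.

(** * Maps on tuples, embeddings and structures pulled back along a map *)

Lemma eq_in_map_tuple (n : nat) (T T' : eqType) (f g : T -> T')
    (t : n.-tuple T) :
  {in t, f =1 g} -> map_tuple f t = map_tuple g t.
Proof. by move=> e; apply/val_inj/eq_in_map. Qed.

Lemma map_tuple_id (n : nat) (T : Type) (t : n.-tuple T) :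
  map_tuple id t = t.
Proof. exact/val_inj/map_id. Qed.

Lemma map_tuple_comp (n : nat) (S T V : Type) (f : T -> V) (g : S -> T)
    (t : n.-tuple S) :
  map_tuple f (map_tuple g t) = map_tuple (f \o g) t.
Proof. by apply/val_inj; rewrite /= -map_comp. Qed.

Lemma embedding_comp (L : language) (S T V : eqType) (M : structure L S)
    (N : structure L T) (K : structure L V) (f : T -> V) (g : S -> T) :
  embedding M N g -> embedding N K f -> embedding M K (f \o g).
Proof.
move=> [gi gR] [fi fR]; split; first exact: inj_comp.
by move=> R t; rewrite -map_tuple_comp fR gR.
Qed.

Lemma automorphism_id (L : language) (T : eqType) (M : structure L T) :
  automorphism M id.
Proof.
split; first by exists id.
by split=> // R t; rewrite map_tuple_id.
Qed.

Lemma automorphism_comp (L : language) (T : eqType) (M : structure L T)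
    (f g : T -> T) :
  automorphism M f -> automorphism M g -> automorphism M (f \o g).
Proof.
move=> [fb fe] [gb ge].
by split; [exact: bij_comp | exact: embedding_comp ge fe].
Qed.

Lemma pullback_uniq (L : language) (S T : eqType) (M : structure L T)
    (p : S -> T) (R : L) (t : (arity R).-tuple S) :
  M R (map_tuple p t) -> uniq t.
Proof. by move/interp_uniq/map_uniq. Qed.

Definition pullback (L : language) (S T : eqType) (M : structure L T)
    (p : S -> T) : structure L S :=
  Structure (@pullback_uniq L S T M p).

Lemma pullback_embedding (L : language) (S T : eqType) (M : structure L T)
    (p : S -> T) :
  injective p -> embedding (pullback M p) M p.
Proof. by []. Qed.

Lemma age_inducedP (L : language) (T : eqType) (M : structure L T)
    (P : pred T) (X : finType) (F : structure L X) :
  age (induced M P) F <->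
  exists2 e : X -> T, embedding F M e & forall x, P (e x).
Proof.
split=> [[f [fi fR]]|[e [ei eR] Pe]].
  exists (val \o f); last by move=> x; exact: (valP (f x)).
  split; first exact: (inj_comp val_inj fi).
  by move=> R t; rewrite -map_tuple_comp; exact: fR.
exists (fun x => exist _ (e x) (Pe x)); split; first by move=> x y [/ei].
by move=> R t; rewrite -eR /= map_tuple_comp.
Qed.

(* Free amalgamation of [X] and [Y] over [B] only concerns tuples from
   [B ++ X ++ Y]: with relations of arity at least 3, points of [X] and [Y] may
   still be adjacent in [M] through points outside that set. *)
Definition indep (L : language) (T : eqType) (M : structure L T)
    (B X Y : seq T) : Prop :=
  (forall x, x \in X -> x \notin Y) /\
  forall (R : L) (t : (arity R).-tuple T),
    M R t -> {subset t <= B ++ X ++ Y} ->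
    {subset t <= B ++ X} \/ {subset t <= B ++ Y}.

Lemma dependent_choice (A : Type) (I : nat -> A -> Prop)
    (r : nat -> A -> A -> Prop) (a0 : A) :
  I 0 a0 ->
  (forall n a, I n a -> exists2 b, I n.+1 b & r n a b) ->
  exists F : nat -> A, forall n, I n (F n) /\ r n (F n) (F n.+1).
Proof.
move=> I0 step.
have next n (a : {a | I n a}) : {b : {b | I n.+1 b} | r n (sval a) (sval b)}.
  apply: constructive_indefinite_description.
  by have [b Ib rb] := step _ _ (svalP a); exists (exist _ b Ib).
pose F := fix F n : {a | I n a} :=
  if n is m.+1 then sval (next m (F m)) else exist _ a0 I0.
exists (fun n => sval (F n)) => n.
by split; [exact: svalP | exact: (svalP (next n (F n)))].
Qed.

(** * Extending finite partial isomorphisms to automorphisms *)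

Section Homogeneous.

Variables (L : language) (T : countType) (U : structure L T).
Hypothesis U_homogeneous : homogeneous U.

(** Homogeneity freed from subtypes: [h] is total, but only its values on [s] matter. *)
Lemma extend_partial (s : seq T) (h : T -> T) :
  {in s &, injective h} ->
  (forall (R : L) (t : (arity R).-tuple T),
     {subset t <= s} -> U R (map_tuple h t) <-> U R t) ->
  exists2 g, automorphism U g & {in s, g =1 h}.
Proof.
move=> hi hR.
pose f (x : {x | x \in s}) : {x | x \in map h s} :=
  exist _ (h (val x)) (map_f h (valP x)).
have fi : injective f.
  by move=> x y [/hi e]; apply/val_inj/e; exact: valP.
pose f' (y : {x | x \in map h s}) : {x | x \in s} :=
  let: exist2 x sx _ := sig2_eqW (elimT mapP (valP y)) in exist _ x sx.
have f'K : cancel f' f.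
  move=> y; rewrite /f'; case: sig2_eqW => x sx e.
  by apply/val_inj; rewrite /= -e.
have [|g ga gh] := @U_homogeneous s (map h s) f.
  split; first by exists f' => // x; apply: fi; rewrite f'K.
  split=> // R t.
  rewrite /= map_tuple_comp -(@map_tuple_comp _ _ _ _ h val) hR //.
  by move=> _ /mapP[x _ ->]; exact: (valP x).
exists g => // x sx.
exact: (gh (exist _ x sx)).
Qed.

(** Sending [e x] to [g x] is a finite partial isomorphism, so homogeneity puts all copies of [F] in
    one orbit. *)
Lemma extend_embedding (X : finType) (F : structure L X) (e g : X -> T) :
  embedding F U e -> embedding F U g ->
  exists2 s, automorphism U s & forall x, s (e x) = g x.
Proof.
move=> [ei eR] [gi gR].
pose h z := if [pick x | e x == z] is Some x then g x else z.
have hE x : h (e x) = g x.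
  rewrite /h; case: pickP => [y /eqP/ei -> //|/(_ x)].
  by rewrite eqxx.
have [|R t ts|s sa sh] := @extend_partial (codom e) h.
- by move=> x' y' /codomP[x ->] /codomP[y ->]; rewrite !hE => /gi ->.
- have iv i : exists x, e x == tnth t i.
    by have /codomP[x ->] := ts _ (mem_tnth i t); exists x.
  have -> : t = map_tuple e [tuple xchoose (iv i) | i < arity R].
    apply: eq_from_tnth => i; rewrite tnth_map tnth_mktuple.
    by rewrite (eqP (xchooseP (iv i))).
  rewrite map_tuple_comp eR -gR.
  by rewrite (@eq_in_map_tuple _ _ _ (h \o e) g) // => x _ /=.
- by exists s => // x; rewrite sh ?codom_f.
Qed.

(* Both [map m w] and [map n w] are free from [X], so the union of the identity
   of [X] and of the map sending [m z] to [n z] is a partial isomorphism. *)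
Lemma extend_free_union (X w : seq T) (m n : T -> T) :
  automorphism U m -> automorphism U n ->
  indep U [::] (map m w) X -> indep U [::] (map n w) X ->
  exists s, [/\ automorphism U s, {in X, s =1 id}
              & {in w, forall z, s (m z) = n z}].
Proof.
move=> [[m' mK m'K] [mi mR]] [_ [ni nR]] [dm fm] [dn fn].
pose h z := if z \in X then z else n (m' z).
have hX z : z \in X -> h z = z by rewrite /h => ->.
have hm z : z \in w -> h (m z) = n z.
  by move=> zw; rewrite /h (negbTE (dm _ (map_f m zw))) mK.
have dmn z : z \in w -> n z \in X -> False.
  by move=> zw; apply/negP/dn/map_f.
have [|R t ts|s sa sh] := @extend_partial (map m w ++ X) h.
- move=> x y; rewrite !mem_cat.
  move=> /orP[/mapP[x' xw ->]|xX] /orP[/mapP[y' yw ->]|yX].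
  + by rewrite !hm // => /ni ->.
  + by rewrite hm // hX // => e; case: (dmn _ xw); rewrite e.
  + by rewrite hm // hX // => e; case: (dmn _ yw); rewrite -e.
  + by rewrite !hX.
- have inX : {subset t <= X} -> map_tuple h t = t.
    move=> tX; rewrite (@eq_in_map_tuple _ _ _ h id) => [|z /tX/hX //].
    exact: map_tuple_id.
  have inw : {subset t <= map m w} -> U R (map_tuple h t) <-> U R t.
    move=> tw; rewrite (@eq_in_map_tuple _ _ _ h (n \o m')); last first.
      by move=> _ /tw/mapP[z zw ->]; rewrite hm //= mK.
    rewrite -map_tuple_comp nR -mR map_tuple_comp.
    rewrite (@eq_in_map_tuple _ _ _ (m \o m') id) => [|z _]; last exact: m'K.
    by rewrite map_tuple_id.
  split=> [Uh|Ut].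
  (* Freeness of [map n w] is applied to the image tuple; disjointness from [X] then tells on which
     side [t] itself lies. *)
  + case: (fn _ _ Uh) => [|/= hw|/= hX'].
    * move=> x /mapP[z /ts]; rewrite /= !mem_cat.
      move=> /orP[/mapP[z' zw ->]|zX] ->; first by rewrite hm // map_f.
      by rewrite hX // zX orbT.
    * apply/inw => // z tz; have := ts _ tz; rewrite mem_cat => /orP[//|zX].
      have := hw _ (map_f h tz); rewrite hX // => /mapP[y yw e].
      by case: (dmn _ yw); rewrite -e.
    * rewrite -inX // => z tz; have := ts _ tz.
      rewrite mem_cat => /orP[/mapP[y yw e]|//].
      by case: (dmn _ yw); rewrite -hm // -e; apply/hX'/map_f.
  + by case: (fm _ _ Ut ts) => [/inw ->|/inX ->].
- exists s; split=> // z zX; first by rewrite sh ?hX // mem_cat zX orbT.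
  by rewrite sh ?hm // mem_cat map_f.
Qed.

Lemma indep_automorphism (s : T -> T) (B X Y : seq T) :
  automorphism U s -> indep U B X Y ->
  indep U (map s B) (map s X) (map s Y).
Proof.
move=> [[s' sK s'K] [si sR]] [d f]; split.
  by move=> _ /mapP[x xX ->]; rewrite mem_map //; exact: d.
move=> R t Ut ts.
have e : t = map_tuple s (map_tuple s' t).
  rewrite map_tuple_comp (@eq_in_map_tuple _ _ _ (s \o s') id) => [|z _ /=].
    exact/esym/map_tuple_id.
  exact: s'K.
rewrite -!map_cat in ts *; move: Ut; rewrite {1}e => /sR Ut.
have back V : {subset map s' t <= V} -> {subset t <= map s V}.
  by move=> sV z tz; rewrite -[z]s'K map_f // sV // map_f.
have [|/back|/back] := f _ _ Ut; [|by left|by right].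
by move=> _ /mapP[z /ts/mapP[y yV ->] ->]; rewrite sK.
Qed.

(** * Realizing free positions by automorphisms *)

Hypothesis U_free : free_amalgamation_age (age U).

(** The free amalgam of [B ++ C] and [B ++ C'] over [B] has a copy in [U]. One automorphism brings
    its first leg back onto [B ++ C]; another, [s], carries [B ++ C'] onto its second leg. *)
Lemma free_position (B C C' : seq T) :
  (forall x, x \in B -> x \notin C) -> (forall x, x \in B -> x \notin C') ->
  exists s, [/\ automorphism U s, {in B, s =1 id}
              & indep U B (map s C') C].
Proof.
move=> BC BC'; have [_ _ amalg] := U_free.
pose p (V : seq T) (x : seq_sub B + seq_sub V) : T :=
  match x with inl b => ssval b | inr v => ssval v end.
have pi V : (forall x, x \in B -> x \notin V) -> injective (@p V).
  move=> BV [[x xB]|[x xV]] [[y yB]|[y yV]] /= e; subst y.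
  - by congr inl; apply/val_inj.
  - by move: (BV _ xB); rewrite yV.
  - by move: (BV _ yB); rewrite xV.
  - by congr inr; apply/val_inj.
have eC := pullback_embedding U (pi _ BC).
have eC' := pullback_embedding U (pi _ BC').
have agr : agree_on_base (pullback U (@p C)) (pullback U (@p C')).
  by move=> R t; rewrite /= !map_tuple_comp.
have [D [D1 D2 DF]] := free_amalgam_exists agr.
have [|||e eD] := amalg _ _ _ _ _ D agr; first by [].
- by exists (@p C).
- by exists (@p C').
have [f fa fE] := extend_embedding (embedding_comp D1 eD) eC.
have eD' : embedding D U (f \o e) := embedding_comp eD fa.2.
have [s sa sE] := extend_embedding eC' (embedding_comp D2 eD').
have [fei feR] := eD'.
have sB x : x \in B -> s x = x.
  by move=> xB; rewrite -{1}[x]/(p C' (inl (SeqSub xB))) sE /= fE.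
have sC x (xC : x \in C') : s x = f (e (inr (SeqSub xC))).
  by rewrite -{1}[x]/(p C' (inr (SeqSub xC))) sE.
have idC x (xC : x \in C) : x = f (e (inl (inr (SeqSub xC)))).
  by rewrite fE.
exists s; split=> //; split.
  move=> _ /mapP[x xC' ->]; apply/negP => sxC.
  by have := idC _ sxC; rewrite {1}(sC _ xC') => /fei.
move=> R t Ut ts.
have iv i : exists x, (f \o e) x == tnth t i.
  have := ts _ (mem_tnth i t); rewrite !mem_cat => /or3P[xB|/mapP[x xC' ->]|xC].
  - by exists (inl (inl (SeqSub xB))); rewrite /= fE.
  - by exists (inr (SeqSub xC')); rewrite sC.
  - by exists (inl (inr (SeqSub xC))); rewrite /= fE.
pose u := [tuple xchoose (iv i) | i < arity R].
have uE : t = map_tuple (f \o e) u.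
  apply: eq_from_tnth => i; rewrite tnth_map tnth_mktuple.
  by rewrite (eqP (xchooseP (iv i))).
have Du : D R u by apply/feR; rewrite -uE.
(* A related tuple of the amalgam that meets the [C'] part misses the [C] part, for lack of
   adjacency. *)
have [/hasP[[//|c'] cu _]|/hasPn noC'] :=
    boolP (has (fun x => if x is inr _ then true else false) u).
  left=> z; rewrite uE => /mapP[[[b|c]|c''] xu ->].
  - by rewrite /= fE mem_cat /= ssvalP.
  - by case: (DF c c'); split=> //; exists R, u.
  - by case: c'' xu => y yC' xu; rewrite /= -sC mem_cat map_f ?orbT.
right=> z; rewrite uE => /mapP[[[b|c]|c''] xu ->].
- by rewrite /= fE mem_cat /= ssvalP.
- by rewrite /= fE mem_cat /= ssvalP orbT.
- by have := noC' _ xu.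
Qed.

(** * Forcing a point out of the red class *)

Hypothesis U_transitive : transitive_automorphisms U.

Variable red : pred T.

Definition placed (w H : seq T) : Prop :=
  exists s, [/\ automorphism U s, {in w, forall z, red (s z)}
              & indep U [::] (map s w) H].

(** Removing heads one by one must stop before the empty list, which the identity always places. *)
Lemma minimal_unplaced (w H : seq T) :
  ~ placed w H ->
  exists a v K, ~ placed (a :: v) K /\ forall K', placed v K'.
Proof.
elim: w H => [|a w IH] H nw.
  case: nw; exists id; split=> //; first exact: automorphism_id.
  by split=> // R t _ tH; right.
have [all|/not_all_ex_not[K /IH //]] := classic (forall K', placed w K').
by exists a, w, H.
Qed.

(** [G] stands for the points already embedded, [y] for the next one. If [s y] were red, it would
    complete a red copy of [w] to a copy of [a :: w] placed with respect to [H]. *)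
Lemma move_to_blue (a : T) (w H G : seq T) (y : T) :
  ~ placed (a :: w) H -> (forall K, placed w K) ->
  (forall x, x \in G -> x \notin H) -> y \notin G ->
  exists s, [/\ automorphism U s, {in G, s =1 id}, ~~ red (s y)
              & s y \notin H].
Proof.
move=> nP Pw GH yG.
(* Otherwise [a :: w] and [w] have the same elements, and placing [w] places [a :: w]. *)
have aw : a \notin w.
  apply/negP => aw; case: nP; have [s [sa sr [sd sf]]] := Pw H.
  have sub z : z \in a :: w -> z \in w by rewrite inE => /orP[/eqP ->|].
  have sub' z : z \in map s (a :: w) -> z \in map s w.
    by move=> /mapP[x /sub xw ->]; exact: map_f.
  exists s; split=> //; first by move=> z /sub/sr.
  split=> [z /sub'/sd //|R t Ut ts].
  case: (sf _ _ Ut) => [z /ts|tw|]; last by right.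
    by rewrite !cat0s !mem_cat => /orP[/sub'|] ->; rewrite ?orbT.
  by left=> z /tw /=; rewrite inE orbC => ->.
have [n [na nr nf]] := Pw (G ++ H).
have [s1 [s1a s1G [s1d s1f]]] : exists s, [/\ automorphism U s, {in G, s =1 id}
    & indep U G (map s [:: y]) H].
  apply: free_position => // x xG.
  by rewrite inE; apply: contra yG => /eqP <-.
set y1 := s1 y in s1d s1f *.
have y1H : y1 \notin H by apply: s1d; rewrite inE.
have y1G : y1 \notin G.
  apply/negP => y1G; have [_ [s1i _]] := s1a.
  by have /s1i e := s1G _ y1G; rewrite -e y1G in yG.
(* The copy of [a :: w] under [d] starts at [y1]; its remaining points are then moved over [y1] to
   be free from [G ++ H]. *)
have [d da dE] := U_transitive a y1.
have [||s2 [s2a s2y [s2d s2f]]] := @free_position [:: y1] (G ++ H) (map d w).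
- by move=> x; rewrite inE => /eqP ->; rewrite mem_cat negb_or y1G.
- move=> x; rewrite inE => /eqP ->; rewrite -dE mem_map //.
  by case: da => _ [].
rewrite -map_comp in s2d s2f; pose m := s2 \o d.
have ma : automorphism U m := automorphism_comp s2a da.
have mE : m a = y1 by rewrite /m /= dE s2y // inE.
have mi : injective m by case: ma => _ [].
have mf : indep U [::] (map m w) (G ++ H).
  split=> // R t Ut ts.
  have ny z : z \in t -> z != y1.
    move=> /ts; apply: contraTneq => ->.
    rewrite /= !mem_cat !negb_or y1G y1H -mE mem_map // aw //.
  case: (s2f _ _ Ut) => [z /ts|tw|tw].
  + by rewrite [_ \in y1 :: _]inE /= => ->; rewrite orbT.
  + by left=> z tz; have := tw _ tz; rewrite inE (negbTE (ny _ tz)).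
  + by right=> z tz; have := tw _ tz; rewrite inE (negbTE (ny _ tz)).
have [s [sa sGH sw]] := extend_free_union ma na mf nf.
have y1wH : indep U [::] (map m (a :: w)) H.
  have dw x : x \in map m w -> (x \notin G) && (x \notin H).
    by move=> /s2d; rewrite mem_cat negb_or.
  split=> [x|R t Ut ts].
    by rewrite /= inE mE => /orP[/eqP -> //|/dw/andP[]].
  have tcase z : z \in t -> [|| z == y1, z \in map m w | z \in H].
    by move=> /ts; rewrite /= inE mem_cat mE.
  case: (s2f _ _ Ut) => [z /tcase|tw|tGH].
  + rewrite inE !mem_cat.
    by case/or3P => ->; rewrite ?orbT.
  + by left=> z /tw; rewrite /= inE mE.
  (* Now [t] lies in [y1 :: G ++ H], so freeness of [y1] from [H] over [G] applies; [t] avoids [G],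
     hence lies in [[:: y1]] or in [H]. *)
  case: (s1f _ _ Ut) => [z /tGH|tG|tG].
  + by rewrite /= !inE !mem_cat inE => /or3P[] ->; rewrite ?orbT.
  + left=> z tz; have := tG _ tz; rewrite mem_cat /= !inE mE.
    case/orP=> [zG|-> //].
    case/or3P: (tcase _ tz) => [-> //|-> |zH]; first by rewrite orbT.
    by have := GH _ zG; rewrite zH.
  + right=> z tz; have := tG _ tz; rewrite mem_cat /=.
    case/orP=> [zG|-> //].
    case/or3P: (tcase _ tz) => [/eqP zy|/dw|//].
      by rewrite zy (negbTE y1G) in zG.
    by rewrite zG.
have sH : map s H = H.
  rewrite -[RHS]map_id; apply/eq_in_map => z zH.
  by rewrite sGH // mem_cat zH orbT.
have := indep_automorphism sa y1wH; rewrite sH -map_comp /= => smf.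
exists (s \o s1); split.
- exact: automorphism_comp.
- by move=> z zG /=; rewrite s1G // sGH // mem_cat zG.
- apply/negP => /= sr; apply: nP; exists (s \o m); split=> //.
  + exact: automorphism_comp.
  + move=> z; rewrite inE /= => /orP[/eqP ->|zw]; first by rewrite mE.
    by rewrite sw // nr.
- by apply: smf.1; rewrite /= mE inE eqxx.
Qed.

(** * Building the embedding point by point *)

Lemma blue_embedding (w H : seq T) :
  ~ placed w H ->
  exists2 f, embedding U U f & forall x, ~~ red (f x).
Proof.
move=> /minimal_unplaced[a [v [K [nP Pv]]]].
(* Images must also avoid [K], so that [move_to_blue] applies again at the next stage. *)
pose good x := ~~ red x && (x \notin K).
pose I n (f : T -> T) :=
  automorphism U f /\ forall x, pickle x < n -> good (f x).
pose r n (f g : T -> T) := forall x : T, pickle x < n -> g x = f x.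
have [||F FP] := @dependent_choice _ I r id.
- by split; [exact: automorphism_id|].
- move=> n f [fa fg].
  (* Stage [n] treats the point of code [n]; a number that codes no point leaves the automorphism
     unchanged. *)
  have [[u un]|nou] := classic (exists u : T, pickle u = n); last first.
    exists f => //; split=> // x; rewrite ltnS leq_eqVlt => /orP[/eqP e|/fg //].
    by case: nou; exists x.
  pose G := map f (pmap pickle_inv (iota 0 n)).
  have inG (x : T) : pickle x < n -> f x \in G.
    move=> xn; apply: map_f; rewrite mem_pmap; apply/mapP.
    by exists (pickle x); rewrite ?mem_iota ?pickleK_inv.
  have GI z : z \in G -> exists2 x : T, pickle x < n & z = f x.
    move=> /mapP[x]; rewrite mem_pmap => /mapP[k].
    rewrite mem_iota /= add0n => kn e ->; exists x => //.
    by have := @pickle_invK T k; rewrite -e /= => ->.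
  have [||s [sa sG sr sK]] := @move_to_blue a v K G (f u) nP Pv.
  + by move=> _ /GI[x /fg/andP[]] _ xK ->.
  + apply/negP => /GI[x xn e]; have [_ [fi _]] := fa.
    by move: xn; rewrite -(fi _ _ e) un ltnn.
  + exists (s \o f).
      split; first exact: automorphism_comp.
      move=> x; rewrite ltnS leq_eqVlt => /orP[/eqP e|xn] /=.
        have -> : x = u by apply: (pcan_inj pickleK); rewrite e un.
        by rewrite /good sr.
      by rewrite sG ?inG // fg.
    by move=> x xn /=; rewrite sG ?inG.
have stable n m (x : T) : pickle x < n -> n <= m -> F m x = F n x.
  move=> xn; elim: m => [|m IH]; first by rewrite leqn0 => /eqP ->.
  rewrite leq_eqVlt => /orP[/eqP -> //|]; rewrite ltnS => nm.
  by rewrite (FP m).2 ?IH // (leq_trans xn).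
(* The limit of the stages: [F n] is settled only on codes below [n], whence the successor. *)
pose f (x : T) := F (pickle x).+1 x.
have fF n (x : T) : pickle x < n -> f x = F n x.
  by move=> xn; rewrite /f (@stable (pickle x).+1 n).
exists f; last by move=> x; have /andP[] := (FP (pickle x).+1).1.2 x (leqnn _).
split=> [x y|R t].
  pose n := (maxn (pickle x) (pickle y)).+1.
  have [[_ [Fi _]] _] := (FP n).1.
  by rewrite !(@fF n) ?ltnS ?leq_maxl ?leq_maxr // => /Fi.
pose n := (\max_(x <- t) pickle x).+1.
have [[_ [_ FR]] _] := (FP n).1.
rewrite (@eq_in_map_tuple _ _ _ f (F n)) // => x xt.
by apply: fF; rewrite ltnS; exact: leq_bigmax_seq.
Qed.

End Homogeneous.

(** * From a structure missing in one colour to the embedding and to indivisibility *)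

Theorem theorem2p4 (L : language) (T : countType) (U : structure L T)
    (U_homogeneous : homogeneous U)
    (U_free : free_amalgamation_age (age U))
    (U_transitive : transitive_automorphisms U) :
  (forall (c : T -> bool) (i : bool),
     ~ same_class (age (induced U (fun x => c x == i))) (age U) ->
     exists2 f : T -> T, embedding U U f & forall x, c (f x) = ~~ i) /\
  age_indivisible U.
Proof.
have main (red : pred T) : ~ same_class (age (induced U red)) (age U) ->
    exists2 f, embedding U U f & forall x, ~~ red (f x).
  move=> nage; apply: NNPP => nof; apply: nage => X F; split.
    by move=> /age_inducedP[e eF _]; exists e.
  move=> [e eF]; apply/age_inducedP; apply: NNPP => noe; apply: nof.
  (* An automorphism placing [codom e], even with respect to the empty list, would yield a red copy
     of [F]. *)
  apply: (@blue_embedding _ _ _ U_homogeneous U_free U_transitive red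
            (codom e) [::]) => -[s [sa sr _]].
  apply: noe; exists (s \o e); first exact: embedding_comp eF sa.2.
  by move=> x; apply/sr/codom_f.
split=> [c i /main[f fe fi]|S0 S1 S01].
  by exists f => // x; move: (fi x); case: (c _) i {fi} => [] [].
have [?|/main[f fe f0]] := classic (same_class (age (induced U S0)) (age U)).
  by left.
right=> X F; split=> [/age_inducedP[e eF _]|[e eF]]; first by exists e.
apply/age_inducedP; exists (f \o e); first exact: embedding_comp eF fe.
by move=> x; rewrite S01 f0.
Qed.
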